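(* Let $A_0\in\mathbb{R}^{n\times n}$, $B\in\mathbb{R}^{n\times m}$, with $(A_0,B)$ controllable, and suppose $A_0$ has no purely imaginary or zero eigenvalues. Let $L\in\mathbb{R}^{n\times n}$ be invertible with $A_0^TL=LD_J$, where $D_J=\mathrm{diag}(D_{J_r},D_{J_\ell})$ is the Jordan form of $A_0^T$, with $D_{J_r}\in\mathbb{R}^{k\times k}$ containing all the eigenvalues of $D_J$ in the open right half plane and $D_{J_\ell}\in\mathbb{R}^{(n-k)\times(n-k)}$ containing all the eigenvalues of $D_J$ in the open left half plane. Let $M=L^TBB^TL$, partitioned conformally with $D_J$ as $M=\begin{bmatrix}M_{11}&M_{12}\\ M_{12}^T&M_{22}\end{bmatrix}$. Let $\mathcal{L}_r$ be the rank $k$ symmetric solution of $-D_{J_r}\mathcal{L}-\mathcal{L}D_{J_r}^T+\mathcal{L}M_{11}\mathcal{L}=0$, let $\mathcal{L}_\ell$ be the rank $n-k$ symmetric solution of $-D_{J_\ell}\mathcal{L}-\mathcal{L}D_{J_\ell}^T+\mathcal{L}M_{22}\mathcal{L}=0$, and put $\mathcal{L}_r^*=\mathrm{diag}(\mathcal{L}_r,0)$ and $\mathcal{L}_\ell^*=\mathrm{diag}(0,\mathcal{L}_\ell)$; these are solutions of $-D_J\mathcal{L}-\mathcal{L}D_J^T+\mathcal{L}M\mathcal{L}=0$. Then every real symmetric solution $\hat{\mathcal{L}}\in\mathbb{R}^{n\times n}$ of $$-D_J\mathcal{L}-\mathcal{L}D_J^T+\mathcal{L}M\mathcal{L}\le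 0$$ satisfies $\mathcal{L}_\ell^*\le\hat{\mathcal{L}}\le\mathcal{L}_r^*$.
   Context: All matrices are real and all solutions are symmetric; $X\le Y$ for symmetric matrices means $Y-X$ is positive semidefinite. ''Jordan form'' means the upper triangular Jordan form; when there are non-real eigenvalues it is taken in its real version, so that $L$ and $D_J$ are real. The full-rank solutions $\mathcal{L}_r$ and $\mathcal{L}_\ell$ of the two smaller equations exist and are unique under the stated assumptions. *)

(* Defs.v *)
From HB Require Import structures.
From mathcomp Require Import all_boot all_order all_algebra.
From mathcomp Require Import reals.
From mathcomp Require Import complex.

Set Implicit Arguments.
Unset Strict Implicit.
Unset Printing Implicit Defensive.

Import Order.TTheory GRing.Theory Num.Theory.
Local Open Scope ring_scope.

(* Spectra of real matrices are taken over the complex numbers. *)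
Definition ceigenvalue (R : realType) (n : nat) (A : 'M[R]_n) (z : R[i]) : bool :=
  eigenvalue (map_mx (real_complex R) A) z.

(* Kalman's condition: [B, A B, ..., A^(n-1) B] has rank n. *)
Definition controllable (R : realType) (n m : nat)
    (A : 'M[R]_n) (B : 'M[R]_(n, m)) : Prop :=
  \rank (\mxrow_(i < n) ((A ^+ i) *m B)) = n.

Definition psdmx (R : realType) (n : nat) (P : 'M[R]_n) : Prop :=
  P^T = P /\ forall x : 'cV[R]_n, 0 <= (x^T *m P *m x) 0 0.

Definition loewner_le (R : realType) (n : nat) (X Y : 'M[R]_n) : Prop :=
  psdmx (Y - X).

Definition jordan_block (R : realType) (d : nat) (a : R) : 'M[R]_d :=
  \matrix_(i, j) (if i == j then a else (j == i.+1 :> nat)%:R).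

(* Real Jordan block of the conjugate pair a + i b, a - i b: the 2 x 2 block
   [a, b; -b, a] repeated q times on the diagonal, and the 2 x 2 identity on
   the block superdiagonal, i.e. a 1 at every entry (i, i + 2). *)
Definition jordan_block_pair (R : realType) (q : nat) (a b : R) : 'M[R]_(q.*2) :=
  \matrix_(i, j)
    (if i == j then a
     else if i./2 == j./2 then (if odd i then - b else b)
     else (j == i.+2 :> nat)%:R).

(* The sign of b is not fixed, so both usual orientations are allowed. *)
Definition is_real_jordan_block (R : realType) (d : nat) (J : 'M[R]_d) : Prop :=
  (0 < d)%N /\
  ((exists a : R, J = jordan_block d a) \/
   (exists (q : nat) (e : q.*2 = d) (a b : R),
      b != 0 /\ J = castmx (e, e) (jordan_block_pair q a b))).

(* Blocks may come in any order. *)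
Definition is_real_jordan_form (R : realType) (n : nat) (J : 'M[R]_n) : Prop :=
  exists (p : nat) (d : 'I_p -> nat) (blk : forall i : 'I_p, 'M[R]_(d i))
         (e : (\sum_i d i)%N = n),
    (forall i, is_real_jordan_block (blk i)) /\
    J = castmx (e, e) (\mxdiag_i blk i).

Definition riccati (R : realType) (n : nat) (D M X : 'M[R]_n) : 'M[R]_n :=
  - (D *m X) - X *m D^T + X *m M *m X.

(* Main.v *)
(* If Y solves the Riccati equation and X the inequality, then E = Y - X
   satisfies (D - Y M) E + E (D - Y M)^T <= - E M E <= 0.  For the solution Y
   supported on the right half plane block, the equation makes Dr - Lr M11
   similar to - Dr^T, so D - Y M is stable and Lyapunov's theorem gives
   E >= 0; the other bound is the same statement for - D, - X and - Y.
   Lyapunov's theorem is proved algebraically: A is triangularized over the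
   complex numbers, and the first row and column of E are cleared by a
   congruence. *)
Require Import Defs.
From HB Require Import structures.
From mathcomp Require Import all_boot all_order all_algebra.
From mathcomp Require Import reals.
From mathcomp Require Import complex.
From mathcomp Require Import ring.

Set Implicit Arguments.
Unset Strict Implicit.
Unset Printing Implicit Defensive.

Import Order.TTheory GRing.Theory Num.Theory.
Local Open Scope ring_scope.

(** * Lyapunov's theorem for Hermitian matrices over a closed numeric field *)

Section Lyapunov.
Local Open Scope sesquilinear_scope.
Variable C : numClosedFieldType.

(** Symmetry is implicit: [0 <= z] in [C] includes that [z] is real, which forces [Q] to be
    Hermitian. *)
Definition hpsdmx n (Q : 'M[C]_n) : Prop :=
  forall x : 'cV[C]_n, 0 <= (x ^t* *m Q *m x) 0 0.

Lemma trmxC_mul m n p (A : 'M[C]_(m, n)) (B : 'M[C]_(n, p)) :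
  (A *m B) ^t* = B ^t* *m A ^t*.
Proof. by rewrite trmx_mul map_mxM. Qed.

Lemma trmxC_block m1 m2 n1 n2 (A : 'M[C]_(m1, n1)) (B : 'M[C]_(m1, n2))
    (D : 'M[C]_(m2, n1)) (E : 'M[C]_(m2, n2)) :
  (block_mx A B D E) ^t* = block_mx (A ^t*) (D ^t*) (B ^t*) (E ^t*).
Proof. by rewrite tr_block_mx map_block_mx. Qed.

Lemma hpsdmx_congr m n (S : 'M[C]_(m, n)) (Q : 'M[C]_n) :
  hpsdmx Q -> hpsdmx (S *m Q *m S ^t*).
Proof.
by move=> Qpsd x; have := Qpsd (S ^t* *m x); rewrite trmxC_mul trmxCK !mulmxA.
Qed.

Lemma hpsdmx_drsub m n (Q : 'M[C]_(m + n)) : hpsdmx Q -> hpsdmx (drsubmx Q).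
Proof.
move=> Qpsd y; have := Qpsd (col_mx 0 y).
rewrite -{1}(submxK Q) tr_col_mx map_row_mx trmx0 map_mx0.
by rewrite mul_row_block mul_row_col !mul0mx !add0r mulmx0 add0r.
Qed.

Lemma hpsdmx_diag_block m n (P : 'M[C]_m) (Q : 'M[C]_n) :
  hpsdmx P -> hpsdmx Q -> hpsdmx (block_mx P 0 0 Q).
Proof.
move=> Ppsd Qpsd x; rewrite -(vsubmxK x) tr_col_mx map_row_mx.
rewrite mul_row_block mul_row_col !mulmx0 addr0 add0r mxE.
exact: addr_ge0.
Qed.

Lemma trmxC_self_ge0 n (q : 'cV[C]_n) : 0 <= (q ^t* *m q) 0 0.
Proof.
by rewrite mxE sumr_ge0 // => i _; rewrite !mxE mulrC mul_conjC_ge0.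
Qed.

Lemma trmxC_self_eq0 n (q : 'cV[C]_n) : (q ^t* *m q) 0 0 = 0 -> q = 0.
Proof.
rewrite mxE => /psumr_eq0P q0; apply/colP => i; rewrite mxE.
have /eqP : (q ^t*) 0 i * q i 0 = 0.
  by apply: q0 => // j _; rewrite !mxE mulrC mul_conjC_ge0.
by rewrite !mxE mulrC mul_conjC_eq0 => /eqP.
Qed.

(* The form at [(- t, q)] is affine in [t] with slope [- 2 |q|^2]. *)
Lemma hpsdmx_ul0 n (q : 'cV[C]_n) (Q : 'M[C]_n) :
  hpsdmx (block_mx (0 : 'M_1) (q ^t*) q Q) -> q = 0.
Proof.
move=> Qpsd; apply: trmxC_self_eq0; apply/eqP; apply: contraT => N0.
set N := (q ^t* *m q) 0 0 in N0.
have Ngt0 : 0 < N by rewrite lt_def N0 trmxC_self_ge0.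
set c := (q ^t* *m Q *m q) 0 0.
have cge0 : 0 <= c.
  by have := hpsdmx_drsub Qpsd q; rewrite block_mxKdr.
(* This [t] brings the value [c - 2 t N] down to [- (c + 2)], negative because [c >= 0]. *)
set t := (c + 1) / N.
have tr : t^* = t by rewrite geC0_conj // divr_ge0 ?addr_ge0 // ltW.
have := Qpsd (col_mx (- t)%:M q).
rewrite tr_col_mx map_row_mx tr_scalar_mx map_scalar_mx /= rmorphN /= tr.
rewrite mul_row_block mul_row_col mulmx0 add0r mulmxDl.
rewrite !(mul_scalar_mx, mul_mx_scalar) -!scalemxAl.
have addE (X Y : 'M[C]_1) : (X + Y) 0 0 = X 0 0 + Y 0 0 by rewrite mxE.
have sclE z (X : 'M[C]_1) : (z *: X) 0 0 = z * X 0 0 by rewrite mxE.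
rewrite !addE !sclE -/N -/c.
have -> : - t * N + (- t * N + c) = - (c + 2).
  by rewrite /t mulNr divfK //; ring.
by rewrite oppr_ge0 => /(lt_le_trans (ltr_wpDl cge0 (@ltr0n C 2))); rewrite ltxx.
Qed.

Lemma trig_block n (A : 'M[C]_(1 + n)) : is_trig_mx A ->
  [/\ ursubmx A = 0, is_trig_mx (drsubmx A) & ulsubmx A = (A 0 0)%:M].
Proof.
move=> /is_trig_mxP At; split.
- by apply/matrixP => i j; rewrite !mxE At // ord1.
- by apply/is_trig_mxP => i j ij; rewrite !mxE At //= ltn_add2l.
- by apply/matrixP => i j; rewrite !ord1 !mxE /=; congr (A _ _); apply/val_inj.
Qed.

(* If [e := E 0 0] vanishes, so does the corner of the semidefinite form
   [- (A E + E A^* )], hence its first column [A' f + a^* f]; stability makes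
   [A' + a^*] invertible, so [f = 0].  In every case [f] is a multiple of [e],
   and [S] below splits [e] off. *)
Lemma lyapunov_trig n (A E : 'M[C]_n) :
    is_trig_mx A -> (forall i, A i i + (A i i)^* < 0) -> E ^t* = E ->
  hpsdmx (- (A *m E + E *m A ^t*)) -> hpsdmx E.
Proof.
elim: n A E => [|n IHn].
  by move=> A E _ _ _ _ x; rewrite mxE big_ord0.
rewrite -[n.+1]/(1 + n)%N => A E At Adiag Eh Qpsd.
have [] := trig_block At.
set a := A 0 0 => Aur; set A' := drsubmx A => A't Aul.
have A'diag i : A' i i + (A' i i)^* < 0 by rewrite !mxE.
have adiag : a + a^* < 0 by exact: Adiag.
set b := dlsubmx A.
have AE : A = block_mx a%:M 0 b A' by rewrite -[LHS]submxK Aur Aul.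
set f := dlsubmx E; set E' := drsubmx E.
set e := E 0 0.
have EE : E = block_mx e%:M (f ^t*) f E'.
  rewrite -[LHS]submxK; congr block_mx.
    by apply/matrixP => i j; rewrite !ord1 !mxE /=; congr (E _ _); apply/val_inj.
  by apply/matrixP => i j; rewrite -[in LHS]Eh !mxE.
have e_real : e^* = e by rewrite /e -[in RHS]Eh !mxE.
have E'h : E' ^t* = E' by apply/matrixP => i j; rewrite /E' -[in RHS]Eh !mxE.
set g := e *: b + A' *m f + a^* *: f.
set Q' := b *m f ^t* + A' *m E' + (f *m b ^t* + E' *m A' ^t*).
have QE : A *m E + E *m A ^t* = block_mx ((a + a^*) * e)%:M (g ^t*) g Q'.
  rewrite AE EE trmxC_block !mulmx_block !mul0mx !addr0 add_block_mx.
  rewrite !trmx0 !map_mx0 !mulmx0 !addr0 !tr_scalar_mx !map_scalar_mx /=.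
  rewrite -!scalar_mxM -raddfD /= !mul_scalar_mx !mul_mx_scalar.
  rewrite mulrDl [_ * a^*]mulrC; congr block_mx => //.
  rewrite /g !linearD !linearZ /= !map_mxD !map_mxZ /= conjCK e_real.
  by rewrite trmxC_mul [RHS]addrC.
(* At the first basis vector the form is [- e] times [a + a^*], and the latter is negative. *)
have ege0 : 0 <= e.
  have : 0 <= - ((a + a^*) * e).
    have := Qpsd (delta_mx 0 0).
    by rewrite trmx_delta map_delta_mx -rowE -colE QE
      (_ : 0 = lshift n 0 :> 'I_(1 + n));
      [rewrite 3!mxE block_mxEul mxE eqxx mulr1n | apply/val_inj].
  by rewrite -mulNr pmulr_rge0 // oppr_gt0.
have [c fE] : exists c : 'cV[C]_n, f = e *: c.
  have [e0|eN0] := eqVneq e 0; last first.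
    by exists (e^-1 *: f); rewrite scalerA divff // scale1r.
  exists 0; rewrite scaler0.
  have : - g = 0.
    apply: (@hpsdmx_ul0 _ _ (- Q')).
    move: Qpsd; rewrite QE e0 mulr0 raddf0 opp_block_mx oppr0.
    by rewrite !raddfN.
  rewrite /g e0 scale0r add0r -mul_scalar_mx -mulmxDl => /eqP.
  rewrite oppr_eq0 => /eqP Bf0.
  have Bunit : A' + a^*%:M \in unitmx.
    rewrite unitmxE det_trig; last first.
      apply/is_trig_mxP => i j ij.
      rewrite mxE (is_trig_mxP A't) // add0r mxE.
      by have /negPf-> : i != j by apply: contraTneq ij => ->; rewrite ltnn.
    rewrite unitfE; apply/prodf_neq0 => i _.
    rewrite mxE [a^*%:M i i]mxE eqxx mulr1n.
    (* A zero entry [A' i i + a^*] would have real part 0, yet twice that real part is the sum of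
       the negative numbers [A' i i + (A' i i)^*] and [a + a^*]. *)
    apply/eqP => z0; have : (A' i i + (A' i i)^*) + (a + a^*) < 0.
      by rewrite -(addr0 0) ltrD.
    have -> : (A' i i + (A' i i)^*) + (a + a^*) =
        (A' i i + a^*) + (A' i i + a^*)^*.
      by rewrite rmorphD /= conjCK; ring.
    by rewrite z0 conjC0 addr0 ltxx.
  by rewrite -[LHS](mulKmx Bunit) Bf0 mulmx0.
pose S := block_mx (1%:M : 'M_1) 0 c 1%:M.
pose T := block_mx (1%:M : 'M_1) 0 (- c) 1%:M.
(* Since [f = e c], this is the Schur complement of the corner [e], written without dividing by [e]
   so that [e = 0] is covered. *)
pose E1 := E' - e *: (c *m c ^t*).
pose F := block_mx (e%:M : 'M_1) 0 0 E1.
have SE : E = S *m F *m S ^t*.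
  rewrite EE fE /S /F trmxC_block !mulmx_block !mul0mx !mulmx0 !mul1mx.
  rewrite !trmx0 !map_mx0 !tr_scalar_mx !map_scalar_mx /= rmorph1.
  rewrite !mulmx0 !mulmx1 !addr0 !add0r /E1 mul_mx_scalar -scalemxAl addrC subrK.
  by rewrite mul_scalar_mx linearZ /= map_mxZ /= e_real.
rewrite SE; apply: hpsdmx_congr; apply: hpsdmx_diag_block.
  by move=> x; rewrite mul_mx_scalar -scalemxAl mxE mulr_ge0 ?trmxC_self_ge0.
have TS : T *m S = 1%:M.
  rewrite /T /S mulmx_block !mul0mx !mulmx0 !mul1mx !mulmx1 !addr0 !add0r.
  by rewrite addNr -scalar_mx_block.
(* All three factors are lower triangular, so conjugation by [S] changes only the lower left block
   and leaves [A'] to the induction. *)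
have TA : T *m A *m S = block_mx a%:M 0 (b - a *: c + A' *m c) A'.
  rewrite AE /T /S !mulmx_block !mul0mx !mulmx0 !mul1mx !mulmx1 !addr0 !add0r.
  by rewrite mul0mx addr0 mul_mx_scalar scalerN [- _ + _]addrC.
apply: (IHn A') => //.
  rewrite /E1 linearB linearZ /= map_mxB map_mxZ /= e_real E'h.
  by rewrite trmxC_mul trmxCK.
(* As [T] inverts [S], congruence by [T] turns the Lyapunov form of [A], [E] into that of [T A S],
   [F]; since [F] is block diagonal, its lower right block is the form of [A'], [E1]. *)
have := hpsdmx_drsub (hpsdmx_congr T Qpsd).
have -> : T *m - (A *m E + E *m A ^t*) *m T ^t* =
   - ((T *m A *m S) *m F + F *m (T *m A *m S) ^t*).
  rewrite mulmxN mulNmx mulmxDr mulmxDl SE; congr (- (_ + _)).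
    by rewrite -!mulmxA -trmxC_mul TS trmx1 map_mx1 mulmx1.
  by rewrite !mulmxA TS mul1mx !trmxC_mul !mulmxA.
rewrite TA /F trmxC_block !mulmx_block add_block_mx opp_block_mx block_mxKdr.
by rewrite mulmx0 mul0mx !add0r.
Qed.

(** Schur's unitary [P] triangularizes [A]. Its inverse is [P ^t*], so the similarity acting on [A]
    and the congruence acting on [E] coincide, and the Lyapunov form follows them. *)
Lemma lyapunov n (A E : 'M[C]_n) :
    (forall z, eigenvalue A z -> z + z^* < 0) -> E ^t* = E ->
  hpsdmx (- (A *m E + E *m A ^t*)) -> hpsdmx E.
Proof.
case: n => [|n] in A E *.
  by move=> _ _ _ x; rewrite mxE big_ord0.
move=> Astab Eh Qpsd.
have [P Pu /= At] := Schur A (ltn0Sn n).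
have Punit := unitarymx_unit Pu.
have PV : P ^t* *m P = 1%:M by rewrite -invmx_unitary // mulVmx.
set T := conjmx P A in At.
have TE : T = P *m A *m P ^t* by rewrite /T conjumx // invmx_unitary.
have -> : E = P ^t* *m (P *m E *m P ^t*) *m (P ^t*) ^t*.
  by rewrite trmxCK !mulmxA PV mul1mx -mulmxA PV mulmx1.
apply: hpsdmx_congr; apply: (lyapunov_trig (A := T)) => //.
- move=> i; apply/Astab/(@eigenvalue_conjmx _ _ _ P).
  + by rewrite stablemx_unit.
  + by rewrite row_free_unit.
  change (eigenvalue T (T i i)).
  rewrite eigenvalue_root_char char_poly_trig // (bigD1 i) //=.
  by rewrite rootM root_XsubC eqxx.
- by rewrite !trmxC_mul trmxCK Eh mulmxA.
have := hpsdmx_congr P Qpsd.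
rewrite mulmxN mulNmx mulmxDr mulmxDl TE !trmxC_mul trmxCK.
by rewrite !mulmxA -!(mulmxA _ (P ^t*) P) PV !mulmx1.
Qed.

End Lyapunov.

(** * Transfer of Lyapunov's theorem to real matrices *)

Section RealLyapunov.
Local Open Scope sesquilinear_scope.
Variable R : realType.
Local Notation toC := (map_mx (real_complex R)).

Lemma trmxC_toC m n (A : 'M[R]_(m, n)) : (toC A) ^t* = toC A^T.
Proof. by apply/matrixP => i j; rewrite !mxE; apply: conjc_real. Qed.

(** For [x = u + i v] the cross terms cancel by symmetry of [Q], leaving [u^T Q u + v^T Q v]. *)
Lemma hpsdmx_toC n (Q : 'M[R]_n) : psdmx Q -> hpsdmx (toC Q).
Proof.
move=> [Qs Qpsd] x.
pose u := map_mx (@complex.Re R) x; pose v := map_mx (@complex.Im R) x.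
have -> : x = toC u + 'i%C *: toC v.
  by apply/matrixP => i j; rewrite !mxE; apply: complexE.
set w := (_ *m _ *m _).
have -> : w = toC (u^T *m Q *m u + v^T *m Q *m v).
  have uv : u^T *m Q *m v = v^T *m Q *m u.
    have tr11 (X : 'M[R]_1) : X^T = X by rewrite [X]mx11_scalar tr_scalar_mx.
    by rewrite -[LHS]tr11 !trmx_mul trmxK Qs mulmxA.
  have xh : (toC u + 'i%C *: toC v) ^t* = toC u^T - 'i%C *: toC v^T.
    apply/matrixP => i j; rewrite !mxE; apply/eqP.
    by rewrite eq_complex /= !(mul0r, mulr0, mul1r, add0r, addr0, oppr0) ?eqxx.
  rewrite /w xh mulmxDl.
  rewrite -scaleNr !(mulmxDl, mulmxDr) -!(scalemxAl, scalemxAr) -!map_mxM.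
  rewrite scalerA mulNr uv -expr2 sqr_i opprK scale1r scaleNr.
  by rewrite addrA addrK map_mxD.
by rewrite mxE ler0c mxE addr_ge0.
Qed.

Lemma psdmx_toC n (Q : 'M[R]_n) : Q^T = Q -> hpsdmx (toC Q) -> psdmx Q.
Proof.
move=> Qs Qpsd; split=> // x; have := Qpsd (toC x).
by rewrite trmxC_toC -!map_mxM mxE ler0c.
Qed.

Lemma real_lyapunov n (A E : 'M[R]_n) :
    (forall z, ceigenvalue A z -> complex.Re z < 0) -> E^T = E ->
  psdmx (- (A *m E + E *m A^T)) -> psdmx E.
Proof.
move=> Astab Es Qpsd; apply: psdmx_toC => //.
apply: (lyapunov (A := toC A)).
- move=> z /Astab z_lt0.
  have -> : z + z^* = 2 * (complex.Re z)%:C%C by exact: addcJ.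
  by rewrite pmulr_rlt0 ?ltr0n // ltcR.
- by rewrite trmxC_toC Es.
by rewrite trmxC_toC -!map_mxM -map_mxD -map_mxN; apply: hpsdmx_toC.
Qed.

(** * Spectra of transposes, opposites, block triangular and closed loop matrices *)

Lemma ceigenvalue_trmx n (A : 'M[R]_n) z : ceigenvalue A^T z = ceigenvalue A z.
Proof.
rewrite /ceigenvalue -map_trmx /eigenvalue /eigenspace !kermx_eq0.
by rewrite !row_free_unit -unitmx_tr linearB /= tr_scalar_mx trmxK.
Qed.

Lemma ceigenvalueN n (A : 'M[R]_n) z : ceigenvalue (- A) z = ceigenvalue A (- z).
Proof.
rewrite /ceigenvalue map_mxN /eigenvalue /eigenspace !kermx_eq0 /row_free.
by rewrite -mxrank_opp opprD !raddfN /= !opprK.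
Qed.

(** In a row eigenvector [(v1, v2)], either [v1] is an eigenvector of [A], or it vanishes and [v2]
    is one of [D]. *)
Lemma ceigenvalue_ublock m n (A : 'M[R]_m) (B : 'M[R]_(m, n)) (D : 'M[R]_n) z :
  ceigenvalue (block_mx A B 0 D) z -> ceigenvalue A z \/ ceigenvalue D z.
Proof.
move=> /eigenvalueP[v]; rewrite map_block_mx map_mx0 -(hsubmxK v).
set v1 := lsubmx v; set v2 := rsubmx v.
rewrite mul_row_block mulmx0 addr0 scale_row_mx => /eq_row_mx[vA vD] v_neq0.
have [v10|v1_neq0] := eqVneq v1 0; last by left; apply/eigenvalueP; exists v1.
right; apply/eigenvalueP; exists v2; first by rewrite -vD v10 mul0mx add0r.
by apply: contraNneq v_neq0 => v20; rewrite v10 v20 row_mx0.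
Qed.

Lemma ceigenvalue_lblock m n (A : 'M[R]_m) (B : 'M[R]_(n, m)) (D : 'M[R]_n) z :
  ceigenvalue (block_mx A 0 B D) z -> ceigenvalue A z \/ ceigenvalue D z.
Proof.
rewrite -ceigenvalue_trmx tr_block_mx trmx0 => /ceigenvalue_ublock.
by rewrite !ceigenvalue_trmx.
Qed.

(* The equation reads [(D - Y M) Y = - Y D^T], a similarity. *)
Lemma riccati_closed_loop n (D M Y : 'M[R]_n) z :
    Y \in unitmx -> riccati D M Y = 0 ->
  ceigenvalue (D - Y *m M) z -> ceigenvalue D (- z).
Proof.
move=> Yu ric0; rewrite -ceigenvalueN -(ceigenvalue_trmx (- D)).
have DY : (D - Y *m M) *m Y = Y *m (- D)^T.
  apply/eqP; rewrite -subr_eq0 -[X in _ == X]oppr0 -ric0 /riccati linearN /=.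
  by rewrite mulmxN mulmxBl !opprD !opprK addrAC.
move=> /eigenvalueP[v vE v_neq0]; apply/eigenvalueP; exists (v *m toC Y).
  by rewrite -mulmxA -map_mxM -DY map_mxM mulmxA vE scalemxAl.
by rewrite mulmx_free_eq0 // row_free_unit map_unitmx.
Qed.

(** * Comparison of solutions of the Riccati inequality *)

(** Exact second order expansion at [Y]: the linear part is minus the Lyapunov operator of the
    closed loop matrix [D - Y M]. Symmetry of [M] and [Y] gives [(Y M)^T = M Y]. *)
Lemma riccati_shift n (D M Y F : 'M[R]_n) : M^T = M -> Y^T = Y ->
  riccati D M (Y + F) = riccati D M Y
    - ((D - Y *m M) *m F + F *m (D - Y *m M)^T) + F *m M *m F.
Proof.
move=> Ms Ys; rewrite /riccati linearB /= trmx_mul Ms Ys.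
rewrite !(mulmxDl, mulmxDr, mulmxN, mulNmx) !mulmxA.
set a := D *m Y; set b := D *m F; set c := Y *m D^T; set d := F *m D^T.
apply/matrixP => i j; rewrite !mxE; ring.
Qed.

(** This symmetry reverses both the Loewner order and the half planes, so the lower bound reduces to
    the upper one. *)
Lemma riccatiN n (D M X : 'M[R]_n) : riccati (- D) M (- X) = riccati D M X.
Proof. by rewrite /riccati [(- D)^T]linearN /= !(mulmxN, mulNmx) !opprK. Qed.

Lemma psdmxD n (P Q : 'M[R]_n) : psdmx P -> psdmx Q -> psdmx (P + Q).
Proof.
move=> [Ps Ppsd] [Qs Qpsd]; split=> [|x]; first by rewrite linearD /= Ps Qs.
by rewrite mulmxDr mulmxDl mxE addr_ge0.
Qed.

Lemma psdmx_congr m n (S : 'M[R]_(m, n)) (Q : 'M[R]_n) :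
  psdmx Q -> psdmx (S *m Q *m S^T).
Proof.
move=> [Qs Qpsd]; split=> [|x].
  by rewrite !trmx_mul trmxK Qs mulmxA.
by have := Qpsd (S^T *m x); rewrite trmx_mul trmxK !mulmxA.
Qed.

Lemma riccati_le_stabilizing n (D M X Y : 'M[R]_n) :
    psdmx M -> X^T = X -> Y^T = Y -> riccati D M Y = 0 ->
    (forall z, ceigenvalue (D - Y *m M) z -> complex.Re z < 0) ->
  loewner_le (riccati D M X) 0 -> loewner_le X Y.
Proof.
move=> Mpsd Xs Ys ric0 stab; rewrite /loewner_le sub0r => ricX.
set E := Y - X; have Es : E^T = E by rewrite linearB /= Xs Ys.
apply: (real_lyapunov stab) => //.
(* With [A = D - Y M], the expansion at [F = - E] writes [- (A E + E A^T)] as the sum of the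
   semidefinite matrices [- riccati D M X] and [E M E]. *)
have := psdmxD ricX (psdmx_congr E Mpsd); rewrite Es.
have -> : X = Y + - E by rewrite opprB addrC subrK.
rewrite riccati_shift ?Mpsd.1 // ric0 sub0r !mulNmx !mulmxN opprK -opprD opprK.
by rewrite opprD subrK.
Qed.

Lemma riccati_ge_antistabilizing n (D M X Y : 'M[R]_n) :
    psdmx M -> X^T = X -> Y^T = Y -> riccati D M Y = 0 ->
    (forall z, ceigenvalue (D - Y *m M) z -> 0 < complex.Re z) ->
  loewner_le (riccati D M X) 0 -> loewner_le Y X.
Proof.
move=> Mpsd Xs Ys ric0 antistab ricX.
suff : loewner_le (- X) (- Y) by rewrite /loewner_le opprK addrC.
have trN (Z : 'M[R]_n) (Zs : Z^T = Z) : (- Z)^T = - Z.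
  by rewrite [LHS]linearN /= Zs.
have ricNX : loewner_le (riccati (- D) M (- X)) 0 by rewrite riccatiN.
have ricNY : riccati (- D) M (- Y) = 0 by rewrite riccatiN.
apply: (riccati_le_stabilizing Mpsd (trN X Xs) (trN Y Ys) ricNY _ ricNX).
(* The closed loop matrix of the negated data is the opposite of [D - Y M]. *)
move=> z; rewrite mulNmx -opprD ceigenvalueN => /antistab.
by case: z => x y /=; rewrite oppr_gt0.
Qed.

End RealLyapunov.

Theorem theorem6 (R : realType) (k l m : nat)
    (A0 : 'M[R]_(k + l)) (B : 'M[R]_(k + l, m)) (L : 'M[R]_(k + l))
    (Dr : 'M[R]_k) (Dl : 'M[R]_l) (DJ M : 'M[R]_(k + l))
    (M11 : 'M[R]_k) (M12 : 'M[R]_(k, l)) (M22 : 'M[R]_l)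
    (Lr : 'M[R]_k) (Ll : 'M[R]_l) (Lrs Lls : 'M[R]_(k + l))
    (hctrl : controllable A0 B)
    (himag : forall z : R[i], ceigenvalue A0 z -> complex.Re z != 0)
    (hL : L \in unitmx)
    (hsim : A0^T *m L = L *m DJ)
    (hDJ : DJ = block_mx Dr 0 0 Dl)
    (hjordan : is_real_jordan_form DJ)
    (hDr : forall z : R[i],
        ceigenvalue Dr z <-> ceigenvalue DJ z /\ 0 < complex.Re z)
    (hDl : forall z : R[i],
        ceigenvalue Dl z <-> ceigenvalue DJ z /\ complex.Re z < 0)
    (hM : M = L^T *m B *m B^T *m L)
    (hMblk : M = block_mx M11 M12 M12^T M22)
    (hLr_sym : Lr^T = Lr)
    (hLr_rank : \rank Lr = k)
    (hLr : riccati Dr M11 Lr = 0)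
    (hLl_sym : Ll^T = Ll)
    (hLl_rank : \rank Ll = l)
    (hLl : riccati Dl M22 Ll = 0)
    (hLrs : Lrs = block_mx Lr 0 0 0)
    (hLls : Lls = block_mx 0 0 0 Ll) :
  [/\ riccati DJ M Lrs = 0,
      riccati DJ M Lls = 0 &
      forall Lhat : 'M[R]_(k + l),
        Lhat^T = Lhat ->
        loewner_le (riccati DJ M Lhat) 0 ->
        loewner_le Lls Lhat /\ loewner_le Lhat Lrs].
Proof.
have simp0 := (mulmx0, mul0mx, addr0, add0r, oppr0, subr0).
(* The zero blocks of [Lrs] remove [M12] and [M22]; the smaller equation survives in the corner. *)
have ric_r : riccati DJ M Lrs = 0.
  rewrite /riccati hDJ hMblk hLrs tr_block_mx !trmx0 !mulmx_block !simp0.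
  by rewrite !opp_block_mx !add_block_mx !simp0 [X in block_mx X]hLr block_mx0.
have ric_l : riccati DJ M Lls = 0.
  rewrite /riccati hDJ hMblk hLls tr_block_mx !trmx0 !mulmx_block !simp0.
  by rewrite !opp_block_mx !add_block_mx !simp0 [X in block_mx _ _ _ X]hLl block_mx0.
have Mpsd : psdmx M.
  have I_psd : psdmx (1%:M : 'M[R]_m).
    split=> [|x]; first exact: trmx1.
    by rewrite mulmx1 mxE sumr_ge0 // => i _; rewrite !mxE sqr_ge0.
  have := psdmx_congr (L^T *m B) I_psd.
  by rewrite mulmx1 trmx_mul trmxK mulmxA -hM.
have Lr_unit : Lr \in unitmx by rewrite -row_free_unit /row_free hLr_rank.
have Ll_unit : Ll \in unitmx by rewrite -row_free_unit /row_free hLl_rank.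
split=> // X Xs ricX; split.
- have Lls_sym : Lls^T = Lls by rewrite hLls tr_block_mx !trmx0 hLl_sym.
  apply: (riccati_ge_antistabilizing Mpsd Xs Lls_sym ric_l _ ricX).
  (* The closed loop matrix is block lower triangular with diagonal blocks [Dr] and [Dl - Ll M22];
     the eigenvalues of the second are opposites of eigenvalues of [Dl], so all lie in the right
     half plane. *)
  move=> z; rewrite hDJ hMblk hLls mulmx_block !simp0.
  rewrite opp_block_mx add_block_mx !simp0 => /ceigenvalue_lblock[/hDr[]//|].
  move=> /(riccati_closed_loop Ll_unit hLl)/hDl[_].
  by case: z => x y /=; rewrite oppr_lt0.
- have Lrs_sym : Lrs^T = Lrs by rewrite hLrs tr_block_mx !trmx0 hLr_sym.
  apply: (riccati_le_stabilizing Mpsd Xs Lrs_sym ric_r _ ricX).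
  (* Here it is block upper triangular, with diagonal blocks [Dr - Lr M11] and [Dl], both with
     spectrum in the left half plane. *)
  move=> z; rewrite hDJ hMblk hLrs mulmx_block !simp0.
  rewrite opp_block_mx add_block_mx !simp0 => /ceigenvalue_ublock[|/hDl[]//].
  move=> /(riccati_closed_loop Lr_unit hLr)/hDr[_].
  by case: z => x y /=; rewrite oppr_gt0.
Qed.
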